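(* Let $X$ be a topological space, $(Z,\lambda)$ a metrizable equiconnected space, $g:X\to Z$ a mapping, and suppose that at least one of the following conditions holds: (1) $CC(X\times X,Z)\subseteq B_1(X^2,Z)$; (2) $X$ is a metrically quarter-stratifiable strongly countably-dimensional paracompact space; (3) $X$ is a metrically quarter-stratifiable space and $(Z,\lambda)$ is locally convex; (4) $X$ is a metrizable space. Then the following conditions are equivalent: (i) $g\in B_1(X,Z)$; (ii) there exists a separately continuous mapping $f:X^2\to Z$ with the diagonal $g$, i.e. $f(x,x)=g(x)$ for every $x\in X$.
   Context: An equiconnected space is a pair $(Z,\lambda)$ consisting of a topological space $Z$ and a continuous function $\lambda:Z\times Z\times[0,1]\to Z$ such that $\lambda(x,y,0)=x$, $\lambda(x,y,1)=y$ and $\lambda(x,x,t)=x$ for all $x,y\in Z$ and $t\in[0,1]$. It is metrizable if the topological space $Z$ is metrizable. It is locally convex if every point of $Z$ has a neighborhood base consisting of sets $U$ that are convex, i.e. $\lambda(U\times U\times[0,1])\subseteq U$. For topological spaces $S$ and $Z$, $B_1(S,Z)$ is the collection of all Baire-one mappings $S\to Z$, i.e. pointwise limits of sequences of continuous mappings $S\to Z$. $X^2=X\times X$ carries the product topology. $CC(X\times X,Z)$ is the collection of all separately continuous mappings $f:X\times X\to Z$, i.e. those for which $x\mapsto f(x,y)$ is continuous for every $y\in X$ and $y\mapsto f(x,y)$ is continuous for every $x\in X$. A topological space $(X,\tau)$ is metrically quarter-stratifiable if there exist a metrizable topology $\tau_m\subseteq\tau$ on $X$ and a function $h:\mathbb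 N\times X\to\tau_m$ such that (a) $X=\bigcup_{x\in X}h(n,x)$ for every $n\in\mathbb N$; (b) if $x\in X$ and $(x_n)_{n=1}^\infty$ is a sequence in $X$ with $x\in h(n,x_n)$ for every $n\in\mathbb N$, then $x_n\to x$ in $(X,\tau)$. A topological space is strongly countably-dimensional if it is a countable union of closed subspaces each of finite covering dimension. *)

(* Defs.v *)
From HB Require Import structures.
From mathcomp Require Import all_boot all_order all_algebra.
From mathcomp Require Import all_classical all_reals all_analysis.

Set Implicit Arguments.
Unset Strict Implicit.
Unset Printing Implicit Defensive.

Import Order.TTheory GRing.Theory Num.Theory.
Import numFieldTopology.Exports.

Local Open Scope classical_set_scope.
Local Open Scope ring_scope.

(* [m] ranges over the metric structures on the carrier [T] itself; only their
   open sets are compared with [tau]. *)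
Definition metrizable_topology (R : realType) (T : Type) (tau : set (set T)) :=
  exists m : Metric.axioms_ R T, tau = @open (Metric.Pack m).

Definition metrizable (R : realType) (T : topologicalType) :=
  metrizable_topology R (@open T).

(* The map is total on [Z * Z * R]; only its values for times in `[0, 1] are
   ever constrained or used. *)
Definition equiconnected (R : realType) (Z : topologicalType)
    (lambda : Z * Z * R -> Z) :=
  [/\ {within setT `*` `[0, 1]%classic, continuous lambda},
      forall x y, lambda (x, y, 0) = x,
      forall x y, lambda (x, y, 1) = y &
      forall x t, t \in `[0, 1] -> lambda (x, x, t) = x].

Definition equiconvex (R : realType) (Z : Type)
    (lambda : Z * Z * R -> Z) (U : set Z) :=
  forall x y t, U x -> U y -> t \in `[0, 1] -> U (lambda (x, y, t)).

Definition equi_locally_convex (R : realType) (Z : topologicalType)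
    (lambda : Z * Z * R -> Z) :=
  forall (z : Z) (V : set Z), nbhs z V ->
    exists U : set Z, [/\ nbhs z U, U `<=` V & equiconvex lambda U].

Definition baire_one (S Z : topologicalType) (g : S -> Z) :=
  exists u : nat -> S -> Z,
    (forall n, continuous (u n)) /\ (forall x, u n x @[n --> \oo] --> g x).

Definition separately_continuous (X Y Z : topologicalType) (f : X * Y -> Z) :=
  (forall y, continuous (fun x => f (x, y))) /\
  (forall x, continuous (fun y => f (x, y))).

Definition metrically_quarter_stratifiable (R : realType)
    (X : topologicalType) :=
  exists tau_m : set (set X),
    [/\ metrizable_topology R tau_m, tau_m `<=` open &
        exists h : nat -> X -> set X,
          [/\ forall n x, tau_m (h n x),
              forall n, \bigcup_x h n x = setT &
              forall (x : X) (u : nat -> X),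
                (forall n, h n (u n) x) -> u n @[n --> \oo] --> x]].

Definition open_cover (T : topologicalType) (UU : set (set T)) :=
  UU `<=` open /\ \bigcup_(U in UU) U = setT.

Definition refines (T : Type) (VV UU : set (set T)) :=
  forall V, VV V -> exists2 U, UU U & V `<=` U.

Definition locally_finite (T : topologicalType) (VV : set (set T)) :=
  forall x : T, exists2 W, nbhs x W &
    finite_set [set V | VV V /\ V `&` W !=set0].

(* The Hausdorff property, often included in paracompactness, is not required
   here: metrically quarter-stratifiable spaces are automatically Hausdorff. *)
Definition paracompact (T : topologicalType) :=
  forall UU : set (set T), open_cover UU ->
    exists VV : set (set T),
      [/\ open_cover VV, refines VV UU & locally_finite VV].

(* Lebesgue covering dimension at most [n]: every finite open cover has a
   finite open refinement with at most [n.+1] members through each point. *)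
Definition covering_dim_le (T : topologicalType) (n : nat) :=
  forall UU : set (set T), finite_set UU -> open_cover UU ->
    exists VV : set (set T),
      [/\ finite_set VV, open_cover VV, refines VV UU &
          forall x : T, ([set V | VV V /\ V x] #<= `I_n.+1)%card].

Definition strongly_countably_dimensional (T : topologicalType) :=
  exists A : nat -> set T,
    [/\ forall k, closed (A k), \bigcup_k A k = setT &
        forall k, exists n, covering_dim_le (set_type (A k)) n].

(* Main.v *)
(** Let [d] metrize [Z], and let [drift (z, w)] be the largest distance from [z] to
    a point of the path [lambda (z, w, .)]: it is continuous and vanishes on the
    diagonal.

    If [g] is the limit of continuous [u_n], then [f (x, y)] is read off the broken
    path [u_0 x, u_1 x, u_2 x, ...], stopped at the first index [n] where [x] and
    [y] are separated, by more than about [2 ^- n], by one of [u_0, ..., u_n].  If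
    they are never separated, [f (x, y) = g x].

    Conversely, let [X] be metrically quarter-stratifiable, as metrizable spaces
    are.  For each [n] the cover [h n] has a sigma-disjoint refinement by metrically
    open sets.  Send [x] in a member of it to [f (x', x)], where [x'] is the center
    attached to that member: these continuous functions tend to [g x] as [n] grows.
    Cutting [X] into countably many zero sets on which they have stabilized up to
    drift [2 ^- m], and patching them with cutoffs along the paths of [lambda]
    (only paths, no higher convex combinations), gives Baire-one [G m] with
    [drift (G m x, G m.+1 x) <= 2 ^- m] and limit [g]; clipping the approximants of
    [G m.+1] to those of [G m] by means of the drift shows that [g] is Baire one. *)
Require Import Defs.
From mathcomp Require Import all_boot all_order all_algebra.
From mathcomp Require Import all_classical all_reals all_analysis.
From mathcomp Require Import lra zify wochoice.

Set Implicit Arguments.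
Unset Strict Implicit.
Unset Printing Implicit Defensive.

Import Order.TTheory GRing.Theory Num.Theory.
Import numFieldNormedType.Exports.

Local Open Scope classical_set_scope.
Local Open Scope ring_scope.

(** * Distance functions and the topologies they induce *)

Definition metric_on (R : realType) (T : Type) (d : T -> T -> R) :=
  [/\ forall x y, d x y = 0 -> x = y, forall x, d x x = 0,
      forall x y, d x y = d y x & forall y x z, d x z <= d x y + d y z].

(** Stated for a distance on a bare type, since [X] will carry a coarser metrizable topology beside
    its own. *)
Definition metric_open (R : realType) (T : Type) (d : T -> T -> R) (U : set T) :=
  forall x, U x -> exists2 e, 0 < e & forall y, d x y < e -> U y.

Lemma metric_on_ge0 (R : realType) (T : Type) (d : T -> T -> R) :
  metric_on d -> forall x y, 0 <= d x y.
Proof.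
case=> _ d0 dC dD x y; have := dD y x x; rewrite d0 (dC y x); lra.
Qed.

Lemma metric_on_dist (R : realType) (T : Type) (d : T -> T -> R) :
  metric_on d -> forall x y x' y', `|d x y - d x' y'| <= d x x' + d y y'.
Proof.
case=> _ d0 dC dD x y x' y'.
have := dD x' x y; have := dD y' x' y; have := dD x x' y'; have := dD y x y'.
rewrite (dC x' x) (dC y' y) ler_norml; lra.
Qed.

Lemma metrizable_topologyP (R : realType) (T : Type) (tau : set (set T)) :
  metrizable_topology R tau -> exists2 d : T -> T -> R, metric_on d &
    forall U, tau U <-> metric_open d U.
Proof.
case=> m ->; pose M := Metric.Pack m.
exists (fun x y : M => mdist x y).
  split=> [x y|x|x y|y x z].
  - exact: (@mdist_positivity _ M).
  - exact: (@mdistxx _ M).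
  - exact: (@metric_sym _ M).
  - exact: (@metric_triangle _ M).
move=> U; split=> [Uo x Ux|H].
  have /nbhs_ballP[e /= e0 eU] : nbhs (x : M) U by exact: open_nbhs_nbhs.
  by exists e => // y xy; apply: eU; rewrite ballEmdist.
rewrite openE => x /H[e e0 eU]; apply/(@nbhs_ballP _ M); exists e => //= y.
by rewrite ballEmdist; exact: eU.
Qed.

Definition metrizes (R : realType) (T : topologicalType) (d : T -> T -> R) :=
  metric_on d /\
  forall x W, nbhs x W <-> exists2 e, 0 < e & forall y, d x y < e -> W y.

Lemma metrizableP (R : realType) (T : topologicalType) :
  metrizable R T -> exists d : T -> T -> R, metrizes d.
Proof.
case/metrizable_topologyP => d dm dP; exists d; split=> // x W.
have [_ d0 dC dD] := dm; rewrite nbhsE; split=> [[U [Uo Ux] UW]|[e e0 eW]].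
  by have [e e0 eU] := (dP U).1 Uo x Ux; exists e => // y /eU /UW.
exists [set y | d x y < e] => //; split; last by rewrite /= d0.
apply/dP => y /= xy; exists (e - d x y); rewrite ?subr_gt0// => z.
by have := dD y x z; lra.
Qed.

Section metrizes.
Context (R : realType) (Z : topologicalType) (d : Z -> Z -> R).
Hypothesis dZ : metrizes d.

Lemma metrizes_near (z : Z) (e : R) : 0 < e -> \forall w \near z, d z w < e.
Proof. by move=> e0; apply/dZ.2; exists e. Qed.

Lemma metrizes_cvg (T : Type) (F : set_system T) {FF : Filter F} (u : T -> Z)
    (z : Z) :
  u @ F --> z <-> forall e, 0 < e -> \forall t \near F, d z (u t) < e.
Proof.
split=> [uz e e0|H W /dZ.2[e e0 eW]].
  exact: (uz (fun w => d z w < e) (metrizes_near z e0)).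
by apply: filterS (H e e0) => t /eW.
Qed.

Lemma cvg_metrizes_lt (T : Type) (F : set_system T) {FF : Filter F}
    (u : T -> Z) (z : Z) e :
  u @ F --> z -> 0 < e -> \forall t \near F, d z (u t) < e.
Proof. by move=> uz; exact: (metrizes_cvg _ _).1. Qed.

Lemma cvg_metrizes (T : Type) (F : set_system T) {FF : Filter F}
    (u v : T -> Z) (y z : Z) :
  u @ F --> y -> v @ F --> z -> d (u t) (v t) @[t --> F] --> d y z.
Proof.
move=> uy vz; apply/cvgrPdist_lt => e e0.
have e20 : 0 < e / 2 by rewrite divr_gt0.
have Hu := @cvg_metrizes_lt _ F FF _ _ _ uy e20.
have Hv := @cvg_metrizes_lt _ F FF _ _ _ vz e20.
apply: filterS2 Hu Hv => t ut vt.
have := metric_on_dist dZ.1 y z (u t) (v t); lra.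
Qed.

End metrizes.

(** * Paths with clamped time, and their drift *)

Section clamp.
Context (R : realType).

Definition clamp (t : R) : R := Num.max 0 (Num.min 1 t).

Lemma clamp_itv t : 0 <= clamp t <= 1.
Proof. by rewrite /clamp le_max lexx/= ge_max ler01 ge_min lexx. Qed.

Lemma clamp_le0 t : t <= 0 -> clamp t = 0.
Proof. by move=> t0; rewrite /clamp max_l// ge_min t0 orbT. Qed.

Lemma clamp_ge1 t : 1 <= t -> clamp t = 1.
Proof. by move=> t0; rewrite /clamp min_l// max_r. Qed.

Lemma continuous_clamp : continuous clamp.
Proof.
move=> x; apply: continuous_max; first exact: cvg_cst.
by apply: continuous_min; [exact: cvg_cst|exact: cvg_id].
Qed.

Lemma cvg_clamp (T : Type) (F : set_system T) {FF : Filter F} (u : T -> R) l :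
  u @ F --> l -> clamp (u t) @[t --> F] --> clamp l.
Proof. by move=> ul; apply: continuous_cvg ul; exact: continuous_clamp. Qed.

End clamp.

Lemma cvg_couple (T : Type) (A B : topologicalType) (F : set_system T)
    {FF : Filter F} (u : T -> A) (v : T -> B) (a : A) (b : B) :
  u @ F --> a -> v @ F --> b -> (u t, v t) @[t --> F] --> (a, b).
Proof. by move=> ua vb; exact: (cvg_pair ua vb). Qed.

Lemma cvg_triple (T : Type) (A B C : topologicalType) (F : set_system T)
    {FF : Filter F} (u : T -> A) (v : T -> B) (w : T -> C) (a : A) (b : B) (c : C) :
  u @ F --> a -> v @ F --> b -> w @ F --> c ->
  (u t, v t, w t) @[t --> F] --> (a, b, c).
Proof. by move=> ua vb wc; exact: (cvg_pair (cvg_pair ua vb) wc). Qed.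

(** Clamping the time turns continuity within the strip of times in [[0, 1]] into continuity
    everywhere, so subspaces disappear from the sequel. *)
Lemma equiconnected_clamp (R : realType) (Z : topologicalType)
    (lambda : Z * Z * R -> Z) : equiconnected lambda ->
  exists L : Z * Z * R -> Z, [/\ continuous L, forall x y, L (x, y, 0) = x,
    forall x y, L (x, y, 1) = y & forall x t, L (x, x, t) = x].
Proof.
case=> lc l0 l1 lxx; exists (fun p => lambda (p.1, clamp p.2)); split=> [|x y|x y|x t] /=.
- move=> [p t]; set A := setT `*` `[0, 1]%classic in lc.
  move/subspace_continuousP : lc => /(_ (p, clamp t)).
  have inA s : A (s.1, clamp s.2) by split=> //=; rewrite in_itv/= clamp_itv.
  move=> /(_ (inA (p, t))) lc W /lc; rewrite /within/= => W'.
  have c : (fun s : Z * Z * R => (s.1, clamp s.2)) @ (p, t) --> (p, clamp t).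
    have c2 : snd @ ((p, t) : Z * Z * R) --> t by exact: cvg_snd.
    have c1 : fst @ ((p, t) : Z * Z * R) --> p by exact: cvg_fst.
    exact: (cvg_couple c1 (cvg_clamp c2)).
  by apply: (@filterS _ _ (nbhs_filter ((p, t) : Z * Z * R))) (c _ W') => s /= /(_ (inA s)).
- by rewrite clamp_le0.
- by rewrite clamp_ge1.
- by apply: lxx; rewrite in_itv/= clamp_itv.
Qed.

(** The supremum is finite by the extreme value theorem. It is continuous because, by compactness of
    [[0, 1]], moving [p] slightly changes [h (p, t)] little, uniformly in [t]. *)
Lemma sup_itv_continuous (R : realType) (P : topologicalType) (h : P * R -> R) :
  continuous h ->
  [/\ forall p t, 0 <= t <= 1 -> h (p, t) <= sup [set h (p, s) | s in `[0, 1]],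
      forall p M, (forall t, 0 <= t <= 1 -> h (p, t) <= M) ->
        sup [set h (p, s) | s in `[0, 1]] <= M &
      continuous (fun p => sup [set h (p, t) | t in `[0, 1]])].
Proof.
move=> hc; set S := fun p => [set h (p, s) | s in `[0, 1]].
have hpc p : continuous (fun t => h (p, t)).
  move=> t; apply: (continuous_cvg _ (hc (p, t))).
  exact: (cvg_couple (cvg_cst p) cvg_id).
have Sne p : S p !=set0 by exists (h (p, 0)), 0 => //; rewrite /= in_itv/= lexx ler01.
have ub p t : 0 <= t <= 1 -> h (p, t) <= sup (S p).
  move=> t01; apply: ub_le_sup; last by exists t; rewrite //= in_itv.
  have [c _ cm] := @EVT_max R (fun t => h (p, t)) 0 1 ler01
    (continuous_subspaceT (hpc p)).
  by exists (h (p, c)) => _ [s /= s01 <-]; exact: cm.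
have le p M : (forall t, 0 <= t <= 1 -> h (p, t) <= M) -> sup (S p) <= M.
  move=> H; apply: ge_sup => // _ [s /= + <-].
  by rewrite in_itv/=; exact: H.
split=> // p; apply/cvgrPdist_le => e e0.
have : \forall q \near p, `[0, 1] `<=` (fun t => `|h (p, t) - h (q, t)| < e).
  apply: (iffLR (compact_near_coveringP _) (@segment_compact R 0 1)) => t _.
  have e20 : 0 < e / 2 by rewrite divr_gt0.
  have /cvgrPdist_lt/(_ _ e20) Ht := hpc p t.
  have /cvgrPdist_lt/(_ _ e20) [[U V] /= [pU tV] UV] := hc (p, t).
  exists (V `&` [set s | `|h (p, t) - h (p, s)| < e / 2], U).
    by split=> //=; exact: filterI.
  move=> [s q] /= [[Vs ps] Uq]; have /= := UV (q, s) (conj Uq Vs).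
  move: ps; rewrite !ltr_norml; lra.
apply: filterS => q H; rewrite ler_norml; apply/andP; split.
  suff : sup (S q) <= sup (S p) + e by rewrite -/(S q) -/(S p); lra.
  apply: le => t t01; have := ub p t t01.
  have := H t; rewrite /= in_itv/= t01 => /(_ isT); rewrite ltr_norml; lra.
suff : sup (S p) <= sup (S q) + e by rewrite -/(S q) -/(S p); lra.
apply: le => t t01; have := ub q t t01.
have := H t; rewrite /= in_itv/= t01 => /(_ isT); rewrite ltr_norml; lra.
Qed.

Definition drift (R : realType) (Z : Type) (d : Z -> Z -> R)
    (L : Z * Z * R -> Z) (p : Z * Z) : R :=
  sup [set d p.1 (L (p, t)) | t in `[0, 1]].

Section drift.
Context (R : realType) (Z : topologicalType) (d : Z -> Z -> R).
Context (L : Z * Z * R -> Z).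
Hypotheses (dZ : metrizes d) (Lc : continuous L).
Hypotheses (L1 : forall x y, L (x, y, 1) = y) (Lxx : forall x t, L (x, x, t) = x).

Let h (p : Z * Z * R) := d p.1.1 (L p).

Let hc : continuous h.
Proof.
move=> p; apply: (cvg_metrizes dZ); last exact: Lc.
exact: (@cvg_comp _ _ _ _ _ _ _ _ cvg_fst cvg_fst).
Qed.

Lemma drift_continuous : continuous (drift d L).
Proof. by have [_ _] := sup_itv_continuous hc. Qed.

Lemma drift_ge p t : 0 <= t <= 1 -> d p.1 (L (p, t)) <= drift d L p.
Proof. by have [H _ _] := sup_itv_continuous hc; exact: H. Qed.

Lemma drift_ge_dist p : d p.1 p.2 <= drift d L p.
Proof.
have /= := @drift_ge p 1; rewrite ler01 lexx => /(_ isT).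
by case: p => x y; rewrite L1.
Qed.

Lemma driftxx z : drift d L (z, z) = 0.
Proof.
have [_ d0 _ _] := dZ.1; apply/eqP; rewrite eq_le; apply/andP; split; last first.
  by have := drift_ge_dist (z, z); rewrite d0.
have [_ + _] := sup_itv_continuous hc; apply=> t _; by rewrite /h Lxx d0.
Qed.

Lemma drift_near z (e : R) : 0 < e -> exists2 r, 0 < r &
  forall x y, d z x < r -> d z y < r -> drift d L (x, y) < e.
Proof.
move=> e0; have /cvgrPdist_lt/(_ _ e0) [[U V] /= [zU zV] UV] := @drift_continuous (z, z).
have [a a0 aU] := (dZ.2 z U).1 zU; have [b b0 bV] := (dZ.2 z V).1 zV.
exists (Num.min a b); rewrite ?lt_min ?a0// => x y.
rewrite !lt_min => /andP[xa _] /andP[_ yb].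
have := UV (x, y) (conj (aU _ xa) (bV _ yb)); rewrite /= driftxx ltr_norml; lra.
Qed.

End drift.

Lemma near_lt_forall (P : nat -> nat -> Prop) (n : nat) :
  (forall i, (i < n)%N -> \forall q \near \oo, P i q) ->
  \forall q \near \oo, forall i, (i < n)%N -> P i q.
Proof.
elim: n => [_|n IH H]; first by apply: filterE.
have Hn := H n (ltnSn n); have {}IH := IH (fun i ni => H i (ltnW ni)).
apply: filterS2 IH Hn => q IHq Hq i; rewrite ltnS leq_eqVlt.
by case/orP=> [/eqP->//|]; exact: IHq.
Qed.

Lemma near_exp2V_lt (R : realType) (e : R) : 0 < e ->
  \forall n \near \oo, 2 ^- n < e.
Proof.
move=> e0; have := near_infty_natSinv_expn_lt (PosNum e0).
by apply: filterS => n /=; rewrite div1r.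
Qed.

(** * Cutoffs and gluing *)

Section cutoffs.
Context (R : realType) (X : topologicalType).

(* For our purposes these sets play the role of zero sets of continuous functions,
   with the advantage that countable intersections only involve finite products. *)
Definition has_cutoffs (T : set X) := exists psi : nat -> X -> R,
  [/\ forall q, continuous (psi q), forall q x, T x -> psi q x = 1 &
      forall x, ~ T x -> \forall q \near \oo, psi q x = 0].

Lemma has_cutoffs_le0 (a : X -> R) :
  continuous a -> has_cutoffs [set x | a x <= 0].
Proof.
move=> ac; exists (fun q x => clamp (1 - q%:R * a x)); split=> [q x|q x /= a0|x /= /negP].
- apply: cvg_clamp; apply: cvgB; first exact: cvg_cst.
  by apply: cvgM; [exact: cvg_cst|exact: ac].
- by rewrite clamp_ge1// lerBrDr gerDl mulr_ge0_le0.
- rewrite -ltNge => a0; have := nbhs_infty_ger (a x)^-1.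
  apply: filterS => q aq; rewrite clamp_le0// subr_le0.
  by rewrite -ler_pdivrMr// div1r.
Qed.

Lemma continuous_prod_ord (a : nat -> X -> R) n :
  (forall k, continuous (a k)) -> continuous (fun x => \prod_(k < n) a k x).
Proof.
move=> ac; elim: n => [|n IH] x.
  by under eq_fun do rewrite big_ord0; exact: cvg_cst.
under eq_fun do rewrite big_ord_recr/=.
by apply: cvgM; [exact: IH|exact: ac].
Qed.

(** Multiply the first [q] cutoffs: off the intersection a single vanishing factor suffices, and it
    takes part as soon as [q] exceeds its index. *)
Lemma has_cutoffs_bigcap (T : nat -> set X) :
  (forall k, has_cutoffs (T k)) -> has_cutoffs (\bigcap_k T k).
Proof.
move=> /choice[psi psiP].
exists (fun q x => \prod_(k < q) psi k q x); split=> [q|q x Tx|x].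
- have H k : continuous (psi k q) by have [+ _ _] := psiP k.
  exact: (@continuous_prod_ord (fun k => psi k q) q H).
- by rewrite big1// => k _; have [_ + _] := psiP k; apply; exact: Tx.
- move=> /existsNP[k /not_implyP[_ Tkx]].
  have [_ _ /(_ x Tkx) H] := psiP k.
  have kq : \forall q \near \oo, (k < q)%N by exists k.+1.
  apply: filterS2 H kq => q psi0 kq.
  by rewrite (bigD1 (Ordinal kq))//= psi0 mul0r.
Qed.

Lemma has_cutoffsI (T1 T2 : set X) :
  has_cutoffs T1 -> has_cutoffs T2 -> has_cutoffs (T1 `&` T2).
Proof.
move=> H1 H2; rewrite -bigcap2E; apply: has_cutoffs_bigcap => -[//|[//|k]] /=.
exists (fun _ => cst 1); split=> //= q x; exact: cvg_cst.
Qed.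

End cutoffs.

Section baire_one.
Context (R : realType) (X Z : topologicalType) (L : Z * Z * R -> Z).
Hypotheses (Lc : continuous L) (L0 : forall x y, L (x, y, 0) = x)
  (L1 : forall x y, L (x, y, 1) = y).

Lemma cvg_path (T : Type) (F : set_system T) {FF : Filter F}
    (u v : T -> Z) (w : T -> R) (a b : Z) (c : R) :
  u @ F --> a -> v @ F --> b -> w @ F --> c ->
  L (u t, v t, w t) @[t --> F] --> L (a, b, c).
Proof.
by move=> ua vb wc; apply: continuous_cvg; [exact: Lc|exact: cvg_triple].
Qed.

(* The [q]-th approximant starts from [U q] and moves along the path to [U p], for
   [p = q - 1, ..., 0], as far as the [q]-th cutoff of [T p] tells: the smallest [p]
   with [x] in [T p] has the last word. *)
Lemma baire_one_glue (T : nat -> set X) (U : nat -> X -> Z) (g : X -> Z) :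
  (forall p, has_cutoffs R (T p)) -> (forall p, continuous (U p)) ->
  (forall x, exists p, [/\ T p x, forall i, (i < p)%N -> ~ T i x &
     g x = U p x]) ->
  baire_one g.
Proof.
move=> /choice[psi psiP] Uc gP.
pose fix V q n i x {struct n} := if n is m.+1 then L (V q m i.+1 x, U i x, psi i q x)
  else U i x.
exists (fun q => V q q 0%N); split.
  move=> q0; move: {1}q0 0%N => q.
  elim: q0 => [|n IH] i x /=; first exact: Uc.
  by apply: cvg_path; [exact: IH|exact: Uc|have [+ _ _] := psiP i; apply].
move=> x; have [p [Tp Tlt ->]] := gP x.
(* At a fixed [x] the approximants are eventually equal to [U p x]: the cutoffs below [p] vanish
   from some [q] on. *)
apply: cvg_near_cst.
have H0 : \forall q \near \oo, forall i, (i < p)%N -> psi i q x = 0.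
  by apply: near_lt_forall => i ip; have [_ _] := psiP i; apply; exact: Tlt.
have pq : \forall q \near \oo, (p < q)%N by exists p.+1.
apply: filterS2 H0 pq => q {}H0 {}pq.
suff : forall n i, (i <= p < i + n)%N -> V q n i x = U p x.
  by apply; rewrite leq0n add0n.
elim=> [i|n IH i /andP[ip pin] /=]; first lia.
have [->|ip'] := eqVneq i p.
  by have [_ psi1 _] := psiP p; rewrite psi1// L1.
by rewrite H0 ?L0 ?IH//; lia.
Qed.

End baire_one.

(** * Limits of Baire-one maps under control of the drift *)

Section baire_one_limit.
Context (R : realType) (X Z : topologicalType) (d : Z -> Z -> R).
Context (L : Z * Z * R -> Z).
Hypotheses (dZ : metrizes d) (Lc : continuous L)
  (L0 : forall x y, L (x, y, 0) = x)
  (L1 : forall x y, L (x, y, 1) = y).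

Local Notation E := (drift d L).

(** The approximants of different [h m] are unrelated, so the diagonal of [v] need not converge.
    Clipped to [w], consecutive ones are close uniformly in [n], and [w n n] converges to [g]. *)
Lemma baire_one_limit (h : nat -> X -> Z) (g : X -> Z) :
  (forall m, baire_one (h m)) ->
  (forall m x, E (h m x, h m.+1 x) <= 2 ^- m) ->
  (forall x, h m x @[m --> \oo] --> g x) -> baire_one g.
Proof.
move=> /choice[v vP] hE hg.
(* The clamped factor is 1 once the drift is below [2 ^- m'], so that [w m] still
   converges to [h m], and 0 beyond [2 * 2 ^- m'], so that [w m n] and [w m.+1 n]
   are close for every [n]. *)
pose fix w m n x {struct m} := if m is m'.+1 then
  L (w m' n x, v m'.+1 n x,
     clamp (2 - 2 ^+ m' * E (w m' n x, v m'.+1 n x))) else v 0%N n x.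
have [_ d0 dC dD] := dZ.1.
have wc m n : continuous (w m n).
  elim: m => [|m IH] x /=; first by have [+ _] := vP 0%N; exact.
  have vc : v m.+1 n @ x --> v m.+1 n x by have [+ _] := vP m.+1; apply.
  apply: (cvg_path Lc) => //; first exact: IH.
  apply: cvg_clamp; apply: cvgB; first exact: cvg_cst.
  apply: cvgM; first exact: cvg_cst.
  apply: continuous_cvg; first exact: (drift_continuous dZ Lc).
  exact: (cvg_couple (IH x) vc).
have wh m x : w m n x @[n --> \oo] --> h m x.
  elim: m => [|m IH] /=; first by have [_] := vP 0%N; apply.
  have vh : v m.+1 n x @[n --> \oo] --> h m.+1 x by have [_] := vP m.+1; apply.
  have -> : h m.+1 x = L (h m x, h m.+1 x, clamp (2 - 2 ^+ m * E (h m x, h m.+1 x))).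
    rewrite clamp_ge1 ?L1//.
    have : 2 ^+ m * E (h m x, h m.+1 x) <= 1.
      by rewrite -ler_pdivlMl ?exprn_gt0// mulr1; exact: hE.
    lra.
  apply: (cvg_path Lc) => //.
  apply: cvg_clamp; apply: cvgB; first exact: cvg_cst.
  apply: cvgM; first exact: cvg_cst.
  apply: continuous_cvg; first exact: (drift_continuous dZ Lc).
  exact: (cvg_couple IH vh).
have wS m n x : d (w m n x) (w m.+1 n x) <= 2 * 2 ^- m.
  rewrite /=; set p := (_, v m.+1 n x); set t := clamp _.
  have := @drift_ge R Z d L dZ Lc p t; rewrite clamp_itv => /(_ isT).
  have [big|small] := leP 2 (2 ^+ m * E p).
    move=> _; rewrite /t clamp_le0; last lra.
    by rewrite L0 d0 mulr_ge0// invr_ge0 exprn_ge0.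
  by move/le_trans; apply; rewrite mulrC ler_pdivlMl ?exprn_gt0// ltW.
(* Telescoping, as [2 * 2 ^- m = 4 * 2 ^- m - 4 * 2 ^- m.+1]. *)
have wD m k n x : d (w m n x) (w (m + k)%N n x) <= 4 * 2 ^- m - 4 * 2 ^- (m + k).
  elim: k => [|k IH]; first by rewrite addn0 d0 subrr.
  rewrite addnS; have := dD (w (m + k)%N n x) (w m n x) (w (m + k).+1 n x).
  have := wS (m + k)%N n x; move: IH; rewrite exprS invfM; lra.
exists (fun n => w n n); split=> [n|x]; first exact: wc.
apply/(metrizes_cvg dZ) => e e0; have e4 : 0 < e / 4 by lra.
have e16 : 0 < e / 16 by lra.
have Ng : \forall m \near \oo, d (g x) (h m x) < e / 4.
  exact: cvg_metrizes_lt (hg x) e4.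
have [m [hm me]] := filter_ex (filterI Ng (near_exp2V_lt e16)).
have : \forall n \near \oo, d (h m x) (w m n x) < e / 4.
  exact: cvg_metrizes_lt (wh m x) e4.
have : \forall n \near \oo, (m <= n)%N by exists m.
apply: filterS2 => n mn hw.
have := wD m (n - m)%N n x; rewrite subnKC// => H.
have : 0 < 2 ^- n :> R by rewrite invr_gt0 exprn_gt0.
have := dD (h m x) (g x) (w n n x); have := dD (w m n x) (h m x) (w n n x).
lra.
Qed.

End baire_one_limit.

Lemma ler_exp2V (R : realType) m n : (m <= n)%N -> 2 ^- n <= 2 ^- m :> R.
Proof.
by move=> mn; rewrite lef_pV2 ?posrE ?exprn_gt0// ler_eXn2l// ltr1n.
Qed.

(** * From a Baire-one map to a separately continuous extension *)

Section diagonal_extension.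
Context (R : realType) (X Z : topologicalType) (d : Z -> Z -> R).
Context (L : Z * Z * R -> Z).
Hypotheses (dZ : metrizes d) (Lc : continuous L)
  (L0 : forall x y, L (x, y, 0) = x)
  (L1 : forall x y, L (x, y, 1) = y) (Lxx : forall x t, L (x, x, t) = x).

Lemma path_near z (e : R) : 0 < e -> exists2 r, 0 < r & forall a b t,
  0 <= t <= 1 -> d z a < r -> d z b < r -> d z (L (a, b, t)) < e.
Proof.
move=> e0; have [r r0 H] := drift_near dZ Lc L1 Lxx z (ltac:(lra) : 0 < e / 2).
have [_ _ _ dD] := dZ.1.
exists (Num.min r (e / 2)) => [|a b t t01]; first by rewrite lt_min r0/= divr_gt0.
rewrite !lt_min => /andP[ar ae] /andP[br _].
have := H a b ar br; have /= := drift_ge dZ Lc (a, b) t01.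
have := dD a z (L (a, b, t)); lra.
Qed.

(** Where [u] separates the coordinates, [f] is locally one of the continuous [v n]. Elsewhere, fix
    one coordinate [c]: then [q n] bounds the distance from [u n c] to [u n] at either coordinate,
    so a small [q n] ties these values to [g c]. *)
Lemma separately_continuous_extension (g : X -> Z) : baire_one g ->
  exists f : X * X -> Z,
    separately_continuous f /\ forall x, f (x, x) = g x.
Proof.
case=> u [uc ug]; have [dI d0 dC dD] := dZ.1.
pose fix q n (p : X * X) {struct n} : R :=
  if n is m.+1 then Num.max (q m p) (d (u m.+1 p.1) (u m.+1 p.2))
  else d (u 0%N p.1) (u 0%N p.2).
(* The time falls from 1 to 0 as [q n.+1] grows from [2 ^- n.+1] to [2 ^- n]. *)
pose s n p := clamp (2 - 2 ^+ n.+1 * q n.+1 p).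
pose fix v n (p : X * X) {struct n} :=
  if n is m.+1 then L (v m p, u m.+1 p.1, s m p) else u 0%N p.1.
pose big n p := 2 ^- n.+1 < q n.+1 p.
have duc n : continuous (fun p : X * X => d (u n p.1) (u n p.2)).
  move=> p; apply: (cvg_metrizes dZ).
    apply: continuous_cvg; [exact: uc|exact: cvg_fst].
  apply: continuous_cvg; [exact: uc|exact: cvg_snd].
have qc n : continuous (q n).
  elim: n => [|n IH] p /=; first exact: duc.
  by apply: continuous_max; [exact: IH|exact: duc].
have ufst n : continuous (fun p : X * X => u n p.1).
  by move=> p; exact: (continuous_cvg _ (@uc n p.1) cvg_fst).
have vc n : continuous (v n).
  elim: n => [|n IH] p /=; first exact: ufst.
  apply: (cvg_path Lc); [exact: IH|exact: ufst|].
  apply: cvg_clamp; apply: cvgB; first exact: cvg_cst.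
  by apply: cvgM; [exact: cvg_cst|exact: qc].
have q_mono m n p : (m <= n)%N -> q m p <= q n p.
  elim: n => [|n IH]; first by rewrite leqn0 => /eqP->.
  rewrite leq_eqVlt => /orP[/eqP->//|mn]; rewrite [q n.+1 p]/= le_max.
  by rewrite IH.
have q_ge n p : d (u n p.1) (u n p.2) <= q n p.
  by case: n => [//|n]; rewrite /= le_max lexx orbT.
have q_gec n p c : p.1 = c \/ p.2 = c -> d (u n c) (u n p.1) <= q n p.
  have qn0 : 0 <= q n p by apply: le_trans (q_ge n p); exact: metric_on_ge0 dZ.1 _ _.
  by case=> <-; [rewrite d0|rewrite dC].
have exp2S n : 2 ^- n = 2 * 2 ^- n.+1 :> R by rewrite exprS invfM mulrA divff// mul1r.
have s0 n p : 2 ^- n <= q n.+1 p -> s n p = 0.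
  move=> H; apply: clamp_le0; rewrite subr_le0 mulrC -ler_pdivrMr ?exprn_gt0//.
  by rewrite -exp2S.
have s1 n p : ~~ big n p -> s n p = 1.
  rewrite -leNgt => H; apply: clamp_ge1.
  have : 2 ^+ n.+1 * q n.+1 p <= 1 by rewrite -ler_pdivlMl ?exprn_gt0// mulr1.
  lra.
(* Past [K] the time is 0, since [q] already exceeds [2 ^- K.+1]. Hence the value of [f] does not
   depend on which [K] with [big K p] is chosen. *)
have stab K p n : big K p -> (K < n)%N -> v n p = v K.+1 p.
  move=> bK; elim: n => [//|n IH]; rewrite ltnS leq_eqVlt.
  case/orP=> [/eqP->//|Kn]; rewrite -IH//= s0 ?L0//.
  apply: le_trans (ler_exp2V R Kn) _; apply/ltW/(lt_le_trans bK).
  by apply: q_mono; lia.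
pose f p := if pselect (exists K, big K p) is left H then v (projT1 (cid H)).+1 p
  else g p.1.
have stab2 p K1 K2 : big K1 p -> big K2 p -> v K1.+1 p = v K2.+1 p.
  move=> b1 b2; case: (leqP K1 K2) => K12; first by rewrite (stab K1 _ K2.+1).
  by rewrite (stab K2 _ K1.+1)// ltnW.
have fbig K p : big K p -> f p = v K.+1 p.
  move=> bK; rewrite /f; case: pselect => [H|[]]; last by exists K.
  by case: (cid H) => K' bK'; exact: stab2.
have fsmall p : (forall K, ~~ big K p) -> f p = g p.1.
  by move=> H; rewrite /f; case: pselect => // -[K] bK; have := H K; rewrite bK.
have fnear c e : 0 < e -> exists M, forall p, p.1 = c \/ p.2 = c ->
    ~~ big M p -> d (g c) (f p) < e.
  move=> e0; have [r r0 rP] := path_near (g c) e0.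
  have r3 : 0 < r / 3 by lra.
  have e3 : 0 < e / 3 by lra.
  have Ng : \forall n \near \oo, d (g c) (u n c) < r / 3 /\ d (g c) (u n c) < e / 3.
    apply: filterI; exact: cvg_metrizes_lt (ug c) _.
  have [M _ MP] : \forall n \near \oo, 2 ^- n < r / 3 /\ 2 ^- n < e / 3 /\
      d (g c) (u n c) < r / 3 /\ d (g c) (u n c) < e / 3.
    apply: filterI; first exact: near_exp2V_lt.
    by apply: filterI; first exact: near_exp2V_lt.
  exists M => p pc bM.
  have [[K bK]|nK] := pselect (exists K, big K p); last first.
    have nK' K : ~~ big K p by apply/negP => bK; apply: nK; exists K.
    rewrite fsmall//.
    have Np : \forall n \near \oo, d (g p.1) (u n p.1) < e / 3.
      exact: cvg_metrizes_lt (ug p.1) e3.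
    have Mn : \forall n \near \oo, (M <= n)%N by exists M.
    have [n [{}Np {}Mn]] := filter_ex (filterI Np Mn).
    have [_ [H2 [_ H4]]] := MP n Mn.
    have qn : q n p <= 2 ^- n.
      apply: le_trans (q_mono _ _ p (leqnSn n)) _.
      by have := nK' n; rewrite -leNgt => /le_trans; apply; exact: ler_exp2V.
    have := q_gec n p c pc; have := dD (u n c) (g c) (g p.1).
    have := dD (u n p.1) (u n c) (g p.1); rewrite (dC (u n p.1) (g p.1)); lra.
  (* The first separation [K'] comes after [M]. All earlier times are 1, so with [K' = k.+1] the
     value lies on the path from [u k.+1] to [u k.+2]. *)
  have [K' bK' Kmin] := ex_minnP (ex_intro (fun K => big K p) K bK).
  have MK : (M < K')%N.
    rewrite ltnNge; apply: contra bM => K'M.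
    apply: le_lt_trans (ler_exp2V R (K'M : (K'.+1 <= M.+1)%N)) _.
    by apply: lt_le_trans bK' _; exact: q_mono.
  rewrite (fbig K')//; case: K' bK' Kmin MK => [//|k] bk kmin Mk.
  have nbk : ~~ big k p by apply/negP => /kmin; rewrite ltnn.
  have -> : v k.+2 p = L (u k.+1 p.1, u k.+2 p.1, s k.+1 p).
    by rewrite /= (s1 k) ?L1.
  have close n : (k < n)%N -> q n p <= 2 ^- k.+1 -> d (g c) (u n p.1) < r.
    move=> kn qn; have [_ [_ [H3 _]]] := MP n (leq_trans (ltnW Mk) kn).
    have [H1 _] := MP k.+1 (ltnW Mk).
    have := q_gec n p c pc; have := dD (u n c) (g c) (u n p.1); lra.
  have c1 : d (g c) (u k.+1 p.1) < r by apply: close; rewrite // leNgt.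
  (* Either the time is 0 and only the starting point matters, or [q k.+2] is small enough to bring
     the endpoint near [g c] as well. *)
  have [big1|small1] := leP (2 ^- k.+1) (q k.+2 p).
    by rewrite s0// L0; have := rP _ _ 0 _ c1 c1; rewrite L0 lexx ler01; apply.
  apply: rP => //; first exact: clamp_itv.
  by apply: close; [lia|exact: ltW].
(* Horizontal and vertical sections are treated at once: [j] runs through pairs having [c] as a
   coordinate. *)
have fc c (j : X -> X * X) : (forall x, (j x).1 = c \/ (j x).2 = c) ->
    continuous j -> continuous (f \o j).
  move=> jc jcont x0.
  have qjc n : q n (j x) @[x --> x0] --> q n (j x0).
    by apply: continuous_cvg; [exact: qc|exact: jcont].
  have [[K bK]|nK] := pselect (exists K, big K (j x0)).
    have bn : \forall x \near x0, big K (j x) by exact: (cvgr_gt _ (qjc K.+1)).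
    have vj : v K.+1 (j x) @[x --> x0] --> v K.+1 (j x0).
      by apply: continuous_cvg; [exact: vc|exact: jcont].
    rewrite /continuous_at/= (fbig K)//; apply: cvg_trans vj.
    by apply: near_eq_cvg; apply: filterS bn => x bx; rewrite /= (fbig K).
  have nK' K : ~~ big K (j x0) by apply/negP => bK; apply: nK; exists K.
  have fgc : g c = f (j x0).
    apply: dI; apply/eqP; rewrite eq_le (metric_on_ge0 dZ.1) andbT.
    apply/ler_addgt0Pl => e e0; rewrite addr0; apply: ltW.
    by have [M MP] := fnear c e e0; exact: MP.
  apply/(metrizes_cvg dZ) => e e0; rewrite /= -fgc.
  have [M MP] := fnear c e e0.
  (* No separation at stage [M.+1] gives [q M.+1 <= 2 ^- M.+2] at [j x0]; the factor 2 to spare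
     yields a strict inequality, which persists nearby. *)
  have bn : \forall x \near x0, q M.+1 (j x) < 2 ^- M.+1.
    apply: (cvgr_lt _ (qjc M.+1)); apply: le_lt_trans (q_mono _ _ _ (leqnSn _)) _.
    have := nK' M.+1; rewrite -leNgt => /le_lt_trans; apply.
    by rewrite (exp2S M.+1) ltr_pMl ?ltr1n// invr_gt0 exprn_gt0.
  by apply: filterS bn => x qx; apply: MP => //; rewrite -leNgt ltW.
exists f; split; last first.
  move=> x; rewrite fsmall// => K; rewrite -leNgt.
  suff -> : q K.+1 (x, x) = 0 by rewrite invr_ge0 exprn_ge0.
  by elim: K.+1 => [|n IH] /=; rewrite ?IH d0// maxxx.
split=> [y x|x y].
  apply: (fc y (fun x => (x, y))) => [x'|x']; first by right.
  exact: (cvg_couple cvg_id (cvg_cst y)).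
apply: (fc x (fun y => (x, y))) => [y'|y']; first by left.
exact: (cvg_couple (cvg_cst x) cvg_id).
Qed.

End diagonal_extension.

(** * Refinements of metrically open covers *)

Section metric_open.
Context (R : realType) (T : Type) (d : T -> T -> R).
Hypothesis dm : metric_on d.

(** A form of Stone's theorem, by well-ordering the indices. The disjoint family at level [s] is
    encoded by the locally constant [idx s] on [O s], its members being the level sets. *)
Lemma sigma_disjoint_refinement (I : eqType) (h : I -> set T) :
  (forall i, metric_open d (h i)) -> (forall x, exists i, h i x) ->
  exists (O : nat -> set T) (idx : nat -> T -> I),
    [/\ forall s x, O s x -> h (idx s x) x, forall x, exists s, O s x &
        forall s x, O s x -> exists2 e, 0 < e &
          forall y, d x y < e -> O s y /\ idx s y = idx s x].
Proof.
move=> ho hcov; have [dI d0 dC dD] := dm.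
have [W Wwo] := well_ordering_principle I.
have /choice[fst fstP] : forall x, exists i, h i x /\ forall j, h j x -> W i j.
  move=> x; have [i hi] := hcov x.
  have /Wwo[j [[jx jmin] _]] : nonempty [pred i | `[< h i x >]].
    by exists i; apply/asboolP.
  exists j; split; first exact/asboolP.
  by move=> k hk; apply: jmin; apply/asboolP.
have Wanti i j : W i j && W j i -> i = j.
  by apply: (@wo_chain_antisymmetric _ _ predT) => //; exact: withinW.
(* With [fst y] the first index whose set contains [y], the [2 ^- s]-balls around
   core points with different first indices are disjoint. *)
pose core s y := forall z, d y z < 3 * 2 ^- s -> h (fst y) z.
pose O s x := exists2 y, core s y & d y x < 2 ^- s.
pose idx s x := if pselect (O s x) is left H then fst (projT1 (cid2 H)) else fst x.
(* The core points are less than [2 * 2 ^- s] apart, so each lies in the set assigned to the other,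
   and neither first index can precede the other strictly. *)
have same s x y y' : core s y -> core s y' -> d y x < 2 ^- s ->
    d y' x < 2 ^- s -> fst y = fst y'.
  move=> cy cy' yx y'x.
  have p : 0 < 2 ^- s :> R by rewrite invr_gt0 exprn_gt0.
  have yy' : d y y' < 3 * 2 ^- s by have := dD x y y'; rewrite (dC x y'); lra.
  apply: Wanti; apply/andP; split.
    by apply: (fstP y).2; apply: cy'; rewrite dC.
  by apply: (fstP y').2; exact: cy.
have idxE s x y : core s y -> d y x < 2 ^- s -> idx s x = fst y.
  move=> cy yx; rewrite /idx; case: pselect => [H|[]]; last by exists y.
  by case: (cid2 H) => y' cy' y'x /=; exact: same y'x yx.
exists O, idx; split=> [s x [y cy yx]|x|s x [y cy yx]].
- rewrite (idxE _ _ y)//; apply: cy; apply: lt_trans yx _.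
  by rewrite ltr_pMl ?ltr1n// invr_gt0 exprn_gt0.
- have [e e0 eh] := ho _ _ (fstP x).1.
  have e3 : 0 < e / 3 by lra.
  have [s /= se] := filter_ex (near_exp2V_lt e3).
  exists s, x; last by rewrite d0 invr_gt0 exprn_gt0.
  by move=> z xz; apply: eh; lra.
- exists (2 ^- s - d y x); first by rewrite subr_gt0.
  move=> z xz; have yz : d y z < 2 ^- s by have := dD x y z; lra.
  by split; [exists y|rewrite (idxE _ _ y)// (idxE _ x y)].
Qed.

(* [phi] is the distance to the complement of [O], truncated at 1. *)
Lemma metric_open_height (O : set T) : metric_open d O ->
  exists phi : T -> R, [/\ forall x, 0 <= phi x, forall x, 0 < phi x <-> O x &
    forall x y, phi x <= phi y + d x y].
Proof.
move=> Oo; have [dI d0 dC dD] := dm; have dge0 := metric_on_ge0 dm.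
pose A x := [set r | 0 <= r <= 1 /\ forall y, d x y < r -> O y].
have A0 x : A x 0.
  by split=> [|y]; rewrite ?lexx ?ler01// ltNge dge0.
have Aub x : has_ubound (A x) by exists 1 => r [/andP[]].
exists (fun x => sup (A x)); split=> [x|x|x y].
- exact: ub_le_sup.
- split=> [/sup_gt|Ox]; first by case=> [|r [_ H] r0]; [exists 0|apply: H; rewrite d0].
  have [e e0 eO] := Oo x Ox.
  apply: (@lt_le_trans _ _ (Num.min e 1)); first by rewrite lt_min e0 ltr01.
  apply: ub_le_sup => //; split=> [|y]; last by rewrite lt_min => /andP[/eO].
  by rewrite le_min ltW//= ler01/= ge_min lexx orbT.
- apply: ge_sup; first by exists 0.
  move=> r [/andP[r0 r1] rO]; rewrite -lerBlDr.
  have [rd|rd] := leP (r - d x y) 0.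
    by apply: le_trans rd _; exact: ub_le_sup.
  apply: ub_le_sup => //; split=> [|z yz].
    by rewrite ltW//= lerBlDr; have := dge0 x y; lra.
  by apply: rO; have := dD y x z; lra.
Qed.

End metric_open.

(** At zeros of [u] the minimum is squeezed between 0 and [u]. This will make [beta] continuous
    although the maps [F a] are only continuous where [phi a] is positive. *)
Lemma continuous_min_off0 (R : realType) (X : topologicalType) (u v : X -> R) :
  continuous u -> (forall x, 0 <= u x) -> (forall x, 0 <= v x) ->
  (forall x, 0 < u x -> v y @[y --> x] --> v x) ->
  continuous (fun x => Num.min (u x) (v x)).
Proof.
move=> uc u0 v0 vc x; have [ux|ux] := ltP 0 (u x).
  by apply: continuous_min; [exact: uc|exact: vc].
have ux0 : u x = 0 by apply/eqP; rewrite eq_le ux u0.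
have ux00 : u y @[y --> x] --> (0 : R) by rewrite -ux0; exact: uc.
have c0 : cst 0 y @[y --> x] --> (0 : R) by exact: cvg_cst.
rewrite /continuous_at ux0 min_l//; apply: squeeze_cvgr c0 ux00.
by apply: nearW => y; rewrite /= le_min u0 v0 ge_min lexx.
Qed.

(** * Diagonals over metrically quarter-stratifiable spaces *)

Section quarter_stratifiable_diagonal.
Context (R : realType) (X Z : topologicalType) (d : Z -> Z -> R).
Context (L : Z * Z * R -> Z).
Hypotheses (dZ : metrizes d) (Lc : continuous L)
  (L0 : forall x y, L (x, y, 0) = x)
  (L1 : forall x y, L (x, y, 1) = y) (Lxx : forall x t, L (x, x, t) = x).

Local Notation E := (drift d L).

Lemma quarter_stratifiable_diagonal (f : X * X -> Z) :
  metrically_quarter_stratifiable R X -> separately_continuous f ->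
  baire_one (fun x => f (x, x)).
Proof.
move=> [tau [/metrizable_topologyP[dX dXm tauP] tau_open [h [htau hcov hcvg]]]].
move=> [fc1 fc2]; have [dI d0 dC dD] := dZ.1.
have [_ dX0 _ dXD] := dXm.
(* A base point of [Z] is needed for [U] below; over an empty [X] everything is vacuous. *)
have [[x00 _]|noX] := pselect (exists x : X, True); last first.
  by exists (fun _ x => f (x, x)); split=> x => [y|]; [case: noX; exists y|case: noX; exists x].
set g := fun x => f (x, x); pose z0 := g x00.
have ball_nbhs x e : 0 < e -> \forall y \near x, dX x y < e.
  move=> e0; apply: open_nbhs_nbhs; split; last by rewrite /= dX0.
  apply: tau_open; apply/tauP => y /= xy; exists (e - dX x y).
    by rewrite subr_gt0.
  by move=> z yz; have := dXD y x z; lra.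
have lip_cont (p : X -> R) : (forall x y, p x <= p y + dX x y) -> continuous p.
  move=> pl x; apply/cvgrPdist_lt => e e0; apply: filterS (ball_nbhs x e e0) => y xy.
  have := pl x y; have := pl y x; have [_ _ dXC _] := dXm.
  by rewrite (dXC y x) ltr_norml; lra.
(* Uniform in the center [x']: a sequence of bad centers would still converge to [x], against
   continuity of [f] in its first variable. *)
have hclose x e : 0 < e -> exists N, forall n, (N <= n)%N -> forall x',
    h n x' x -> d (g x) (f (x', x)) < e.
  move=> e0; apply: contrapT => /forallNP H.
  (* [u n] is a bad center for [x] whenever there is one. *)
  have /choice[u uP] : forall n, exists x', h n x' x /\
      ((exists2 x', h n x' x & ~ d (g x) (f (x', x)) < e) ->
        ~ d (g x) (f (x', x)) < e).
    move=> n; have [[x' hx' bad]|nobad] :=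
        pselect (exists2 x', h n x' x & ~ d (g x) (f (x', x)) < e).
      by exists x'.
    have : (\bigcup_x' h n x') x by rewrite hcov.
    by case=> x' _ hx'; exists x'.
  have ux : u n @[n --> \oo] --> x by apply: hcvg => n; have [] := uP n.
  have fux : f (u n, x) @[n --> \oo] --> f (x, x).
    exact: (continuous_cvg _ (@fc1 x x) ux).
  have [N _ NP] : \forall n \near \oo, d (g x) (f (u n, x)) < e.
    exact: cvg_metrizes_lt fux e0.
  apply: (H N) => n Nn x' hx'; apply: contrapT => bad.
  by have [_] := uP n; apply; [exists x'|exact: NP].
have /choice[V /choice[idx VP]] : forall n, exists V, exists idx : nat -> X -> X,
    [/\ forall s x, V s x -> h n (idx s x) x, forall x, exists s, V s x &
        forall s x, V s x -> exists2 e, 0 < e &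
          forall y, dX x y < e -> V s y /\ idx s y = idx s x].
  move=> n; apply: sigma_disjoint_refinement => // [i|x]; first exact/tauP.
  have : (\bigcup_x' h n x') x by rewrite hcov.
  by case=> i _ hi; exists i.
have /choice[phi phiP] : forall a : nat * nat, exists phi : X -> R,
    [/\ forall x, 0 <= phi x, forall x, 0 < phi x <-> V a.1 a.2 x &
    forall x y, phi x <= phi y + dX x y].
  move=> a; apply: metric_open_height => // x Vx.
  have [_ _ H] := VP a.1; have [e e0 eP] := H _ _ Vx.
  by exists e => // y /eP[].
have phi_ge0 a x : 0 <= phi a x by have [+ _ _] := phiP a; exact.
have phi_gt0 a x : 0 < phi a x <-> V a.1 a.2 x by have [_ + _] := phiP a; exact.
have phic a : continuous (phi a) by have [_ _ /lip_cont] := phiP a.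
(* Here [a] consists of a cover number and a level. Where [phi a] is positive the center is locally
   constant, so continuity in the second variable applies. *)
pose F (a : nat * nat) x := f (idx a.1 a.2 x, x).
have Fc a x : 0 < phi a x -> F a y @[y --> x] --> F a x.
  move=> /phi_gt0 Vx; have [_ _ H] := VP a.1; have [e e0 eP] := H _ _ Vx.
  apply: cvg_trans (@fc2 (idx a.1 a.2 x) x); apply: near_eq_cvg.
  apply: filterS (ball_nbhs x e e0) => y /eP[_ idxE].
  by rewrite /F idxE.
have Fclose x e : 0 < e -> exists N, forall a, (N <= a.1)%N -> 0 < phi a x ->
    d (g x) (F a x) < e.
  move=> /(hclose x)[N NP]; exists N => a Na /phi_gt0 Vx.
  by apply: (NP a.1) => //; have [H _ _] := VP a.1; exact: H.
(* The drift is taken in both directions because nothing is known about which of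
   [G m x], [G m.+1 x] below comes from the finer cover. *)
pose c m a b x := Num.max (E (F a x, F b x)) (E (F b x, F a x)) - 2 ^- m.
pose beta m a b x := Num.min (Num.min (phi a x) (phi b x)) (Num.max 0 (c m a b x)).
have betac m a b : continuous (beta m a b).
  apply: continuous_min_off0 => [x|x|x|x].
  - by apply: continuous_min; exact: phic.
  - by rewrite le_min !phi_ge0.
  - by rewrite le_max lexx.
  - rewrite lt_min => /andP[/Fc Fa /Fc Fb].
    apply: continuous_max; first exact: cvg_cst.
    apply: cvgB; last exact: cvg_cst.
    have Ec := drift_continuous dZ Lc.
    have Eab : {for x, continuous (fun y => E (F a y, F b y))}.
      exact: (continuous_cvg _ (@Ec (F a x, F b x)) (cvg_couple Fa Fb)).
    have Eba : {for x, continuous (fun y => E (F b y, F a y))}.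
      exact: (continuous_cvg _ (@Ec (F b x, F a x)) (cvg_couple Fb Fa)).
    exact: (continuous_max Eab Eba).
have betaP m a b x : beta m a b x <= 0 <-> (0 < phi a x -> 0 < phi b x ->
    E (F a x, F b x) <= 2 ^- m /\ E (F b x, F a x) <= 2 ^- m).
  rewrite /beta !ge_min ge_max lexx/= subr_le0 ge_max.
  split=> [|H].
    case/orP=> [/orP[]|/andP[]//]; rewrite leNgt => /negP ? ? ?; contradiction.
  have [//|/H{}H] := leP (phi a x) 0; have [//|/H[-> ->]] := leP (phi b x) 0.
  by rewrite !orbT.
have cutT : has_cutoffs R (setT : set X).
  exists (fun _ => cst 1); split=> //= q x; exact: cvg_cst.
pose e2 k : nat * nat := odflt (0, 0)%N (unpickle k).
have e2K a : exists k, e2 k = a by exists (pickle a); rewrite /e2 pickleK.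
pose e3 k : (nat * nat) * nat := odflt (0, 0, 0)%N (unpickle k).
have e3K a : exists k, e3 k = a by exists (pickle a); rewrite /e3 pickleK.
(* For [p = (a, k)]: [phi a] is at least [1 / k.+1], and [F a] agrees up to drift [2 ^- m] with
   every [F b] defined at [x] whose cover number is no smaller. *)
pose T m (p : (nat * nat) * nat) : set X := [set x | 1 - p.2.+1%:R * phi p.1 x <= 0] `&`
  \bigcap_k (if (p.1.1 <= (e2 k).1)%N then [set x | beta m p.1 (e2 k) x <= 0] else setT).
(* A continuous extension of [F a] from the set where [phi a >= 1 / k.+1]: it rests at [z0] until
   [phi a] reaches half that height. *)
pose U (p : (nat * nat) * nat) x :=
  L (z0, F p.1 x, clamp (2 * p.2.+1%:R * phi p.1 x - 1)).
have Tcut m p : has_cutoffs R (T m p).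
  apply: has_cutoffsI.
    apply: has_cutoffs_le0 => x; apply: cvgB; first exact: cvg_cst.
    by apply: cvgM; [exact: cvg_cst|exact: phic].
  by apply: has_cutoffs_bigcap => k; case: ifP => // _; exact: has_cutoffs_le0.
have Tphi m p x : T m p x -> 0 < phi p.1 x.
  move=> [/= + _]; rewrite subr_le0 => /(lt_le_trans ltr01).
  by rewrite pmulr_rgt0.
have Tbeta m p b x : T m p x -> (p.1.1 <= b.1)%N -> beta m p.1 b x <= 0.
  move=> [_ H] pb; have [k ek] := e2K b.
  by have := H k I; rewrite ek pb.
have TU m p x : T m p x -> U p x = F p.1 x.
  move=> [/= + _]; rewrite subr_le0 => H; rewrite /U clamp_ge1 ?L1//.
  by rewrite -mulrA; lra.
(* From some cover [N] on, all available values at [x] lie in a ball around [g x] where drifts are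
   below [2 ^- m]; any member of cover [N] through [x] will do. *)
have Tcov m x : exists p, T m p x.
  have [r r0 rP] := drift_near dZ Lc L1 Lxx (g x) (ltac:(by rewrite invr_gt0 exprn_gt0) : 0 < 2 ^- m :> R).
  have [N NP] := Fclose x r r0.
  have [_ Vcov _] := VP N; have [s Ns] := Vcov x.
  have ps : 0 < phi (N, s) x by apply/phi_gt0.
  have [k _ kP] : \forall k \near \oo, (phi (N, s) x)^-1 <= k%:R := nbhs_infty_ger _.
  exists ((N, s), k); split=> /=.
    rewrite subr_le0 -ler_pdivrMr// div1r; apply: (le_trans (kP k (leqnn k))).
    by rewrite ler_nat.
  move=> j _ /=; case: ifP => // Nj; apply/betaP => _ pj.
  by split; apply/ltW; apply: rP; apply: NP.
have Uc p : continuous (U p).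
  move=> x; have [px|px] := ltP 0 (phi p.1 x).
    apply: (cvg_path Lc); [exact: cvg_cst|exact: Fc|].
    apply: cvg_clamp; apply: cvgB; last exact: cvg_cst.
    by apply: cvgM; [exact: cvg_cst|exact: phic].
  have near0 : \forall y \near x, 2 * p.2.+1%:R * phi p.1 y < 1.
    apply: (cvgr_lt (2 * p.2.+1%:R * phi p.1 x)).
      by apply: cvgM; [exact: cvg_cst|exact: phic].
    apply: le_lt_trans ltr01; rewrite mulr_ge0_le0//.
  have U0 y : 2 * p.2.+1%:R * phi p.1 y < 1 -> U p y = z0.
    by move=> H; rewrite /U clamp_le0 ?L0// subr_le0 ltW.
  rewrite /continuous_at; have -> : U p x = z0 by apply: U0; exact: nbhs_singleton near0.
  apply: cvg_near_cst; apply: filterS near0 => y; exact: U0.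
(* The least code is taken because [baire_one_glue] lets the first set containing [x] decide. *)
have /choice[P PP] : forall mx : nat * X, exists p, [/\ T mx.1 (e3 p) mx.2 &
    forall i, (i < p)%N -> ~ T mx.1 (e3 i) mx.2].
  move=> [m x] /=; have [p Tp] := Tcov m x; have [k ek] := e3K p.
  have ex : exists k, `[< T m (e3 k) x >] by exists k; apply/asboolP; rewrite ek.
  have [j /asboolP Tj jmin] := ex_minnP ex.
  by exists j; split=> // i ij /asboolP /jmin; rewrite leqNgt ij.
pose G m x := U (e3 (P (m, x))) x.
have GF m x : exists a : nat * nat, [/\ G m x = F a x, 0 < phi a x & forall b,
    (a.1 <= b.1)%N -> 0 < phi b x ->
    E (F a x, F b x) <= 2 ^- m /\ E (F b x, F a x) <= 2 ^- m].
  have [/= Tx _] := PP (m, x); exists (e3 (P (m, x))).1; split.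
  - exact: TU Tx.
  - exact: Tphi Tx.
  - move=> b ab; apply: (betaP m _ b x).1; last exact: Tphi Tx.
    exact: Tbeta.
apply: (baire_one_limit dZ Lc L0 L1 (h := G)) => [m|m x|x].
- apply: (baire_one_glue Lc L0 L1 (T := fun p => T m (e3 p)) (U := fun p => U (e3 p))) => [p|p|x].
  + exact: Tcut.
  + exact: Uc.
  + by have [] := PP (m, x); exists (P (m, x)).
- have [a [-> pa aP]] := GF m x; have [b [-> pb bP]] := GF m.+1 x.
  (* Whichever of [a], [b] has the smaller cover number controls the other. *)
  have [ab|ba] := leqP a.1 b.1; first by have [] := aP b ab pb.
  have [_ +] := bP a (ltnW ba) pa; move/le_trans; apply.
  exact: ler_exp2V.
- apply/(metrizes_cvg dZ) => e e0; have e20 : 0 < e / 2 by lra.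
  apply: filterS (near_exp2V_lt e20) => m me.
  have [a [-> pa aP]] := GF m x; have [N NP] := Fclose x _ e20.
  have [_ Vcov _] := VP (maxn N a.1); have [s Ns] := Vcov x.
  (* The cover number of [a] need not be large, so [F a x] is compared with [g x] through a finer
     [b], close to both. *)
  pose b := (maxn N a.1, s); have pb : 0 < phi b x by apply/phi_gt0.
  have [_ Eba] := aP b (leq_maxr _ _) pb.
  have := NP b (leq_maxl _ _) pb; have := drift_ge_dist dZ Lc L1 (F b x, F a x).
  have := dD (F b x) (g x) (F a x); rewrite /=; lra.
Qed.

End quarter_stratifiable_diagonal.

(** * Metrizable spaces, and the equivalence *)

Lemma metrizable_quarter_stratifiable (R : realType) (X : topologicalType) :
  metrizable R X -> metrically_quarter_stratifiable R X.
Proof.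
move=> mX; have [d dX] := metrizableP mX; have [_ d0 _ dD] := dX.1.
exists open; split=> //; exists (fun n x => [set y | d x y < 2 ^- n]); split.
- move=> n x; rewrite openE => y /= xy; apply/dX.2.
  exists (2 ^- n - d x y) => [|z /= yz]; first by rewrite subr_gt0.
  by have := dD y x z; lra.
- move=> n; apply/seteqP; split=> // x _; exists x => //=.
  by rewrite d0 invr_gt0 exprn_gt0.
- move=> x u ux; apply/(metrizes_cvg dX) => e e0.
  apply: filterS (near_exp2V_lt e0) => n ne; have [_ _ dC _] := dX.1.
  by rewrite dC; exact: lt_trans (ux n) ne.
Qed.

Theorem theorem3p3 (R : realType) (X Z : topologicalType)
    (lambda : Z * Z * R -> Z) (g : X -> Z)
    (metrizableZ : metrizable R Z)
    (equiconnectedZ : equiconnected lambda)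
    (hyp : [\/ forall f : X * X -> Z, separately_continuous f -> baire_one f,
               [/\ metrically_quarter_stratifiable R X,
                   strongly_countably_dimensional X & paracompact X],
               metrically_quarter_stratifiable R X /\
                 equi_locally_convex lambda
             | metrizable R X]) :
  baire_one g <->
  exists f : X * X -> Z,
    separately_continuous f /\ forall x, f (x, x) = g x.
Proof.
have [d dZ] := metrizableP metrizableZ.
have [L [Lc L0 L1 Lxx]] := equiconnected_clamp equiconnectedZ.
split=> [g1|[f [fs fg]]].
  exact: (separately_continuous_extension dZ Lc L0 L1 Lxx g1).
have mqs : metrically_quarter_stratifiable R X -> baire_one g.
  move=> qX; have -> : g = fun x => f (x, x) by apply/funext => x; rewrite fg.
  exact: (quarter_stratifiable_diagonal dZ Lc L0 L1 Lxx qX fs).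
case: hyp => [H|[qX _ _]|[qX _]|mX]; [|exact: mqs|exact: mqs|].
  (* Under the first condition, the approximants of [f] are restricted to the diagonal. *)
  have [u [uc uf]] := H f fs; exists (fun n x => u n (x, x)); split=> [n x|x].
    exact: (continuous_cvg _ (uc n (x, x)) (cvg_couple cvg_id cvg_id)).
  by rewrite -fg; exact: uf.
exact/mqs/metrizable_quarter_stratifiable.
Qed.
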